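(* For any valley-free range map $\delta$, the ideal $\mathcal{R}_\delta$ of $\mathbb{K}\langle\mathbb{A}_{\mathcal{P}_\delta}\rangle$ is minimally generated by the set $$\min_{\leq_{\mathrm{s}}}\{a^u a_v:u\in\mathsf{Cl}_\delta,\ v\in\mathcal{P}_\delta,\text{ and }uv\notin\mathsf{Cl}_\delta\},$$ that is, this set generates $\mathcal{R}_\delta$ as a two-sided ideal and no proper subset of it does.
   Context: $\mathbb{K}$ is a field of characteristic zero, $\mathbb{N}=\{0,1,2,\dots\}$. A range map is a map $\delta:\mathbb{N}\setminus\{0\}\to\mathbb{N}$; it is valley-free if there are no $1\leq i_1<i_2<i_3$ with $\delta(i_1)>\delta(i_2)<\delta(i_3)$. A $\delta$-cliff is a finite word $u=u_1\cdots u_n$ of nonnegative integers with $u_i\leq\delta(i)$ for all $i$; $\mathsf{Cl}_\delta$ is the set of all of them, including the empty word $\epsilon$; $uv$ denotes concatenation of words. A nonempty $\delta$-cliff $u$ is $\delta$-prime if $u=vw$ with $v,w\in\mathsf{Cl}_\delta$ implies $v=\epsilon$ or $w=\epsilon$. $\mathcal{P}_\delta$ is the set of $\delta$-prime $\delta$-cliffs. $\mathbb{A}_{\mathcal{P}_\delta}=\{a_u:u\in\mathcal{P}_\delta\}$ is a set of noncommuting variables and $\mathbb{K}\langle\mathbb{A}_{\mathcal{P}_\delta}\rangle$ is the free unital associative algebra on it. Every $u\in\mathsf{Cl}_\delta$ factors in a unique way as a concatenation $u=u^{(1)}\cdots u^{(k)}$, $k\geq0$, of $\delta$-prime $\delta$-cliffs,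 and $a^u$ denotes the monomial $a_{u^{(1)}}\cdots a_{u^{(k)}}$. $\mathcal{R}_\delta$ is the linear span of all monomials $a_{u^{(1)}}\cdots a_{u^{(k)}}$ with $k\geq1$, $u^{(i)}\in\mathcal{P}_\delta$ for all $i$, and $u^{(1)}\cdots u^{(k)}\notin\mathsf{Cl}_\delta$; for valley-free $\delta$ it is a two-sided ideal. For monomials, $a_{u^{(1)}}\cdots a_{u^{(k)}}\leq_{\mathrm{s}}a_{v^{(1)}}\cdots a_{v^{(\ell)}}$ means that the word $u^{(1)}\cdots u^{(k)}$ is a suffix of the word $v^{(1)}\cdots v^{(\ell)}$; for a set $M$ of monomials, $\min_{\leq_{\mathrm{s}}}M$ is the set of elements of $M$ that are minimal for $\leq_{\mathrm{s}}$. *)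

(* Defs.v *)
From mathcomp Require Import all_boot all_algebra.
From mathcomp Require Import boolp classical_sets.
From mathcomp.multinomials Require Import monalg.

Set Implicit Arguments.
Unset Strict Implicit.
Unset Printing Implicit Defensive.

Import GRing.Theory.
Local Open Scope classical_set_scope.
Local Open Scope ring_scope.

(* A range map is encoded as a total function [delta : nat -> nat]; only its  *)
(* values at positive integers are ever used.                                 *)
Definition valley_free (delta : nat -> nat) : Prop :=
  forall i1 i2 i3 : nat, (1 <= i1 < i2)%N -> (i2 < i3)%N ->
    ~ ((delta i2 < delta i1)%N /\ (delta i2 < delta i3)%N).

(* Positions in words start at 1, whereas [nth] counts from 0.                *)
Definition cliffs (delta : nat -> nat) : set (seq nat) :=
  [set u | forall i : nat, (i < size u)%N -> (nth 0%N u i <= delta i.+1)%N].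

Definition prime_cliffs (delta : nat -> nat) : set (seq nat) :=
  [set u | [/\ u <> [::], cliffs delta u &
     forall v w : seq nat, cliffs delta v -> cliffs delta w ->
       u = v ++ w -> v = [::] \/ w = [::]]].

Definition monomial (delta : nat -> nat) : monomType :=
  {fmonom (prime_cliffs delta : Type)}.

Definition free_algebra (K : fieldType) (delta : nat -> nat) : lalgType K :=
  {malg K[monomial delta]}.

Section Monomials.
Variable delta : nat -> nat.

Definition word (m : monomial delta) : seq nat :=
  flatten [seq val p | p <- fmonom_val m].

Definition letter (v : prime_cliffs delta) : monomial delta := fmu v.

(* The monomial a^u of a cliff u. By [word_cliff_monomial] and [word_inj] it  *)
(* is the unique monomial with word u; it is junk if u is not a cliff.        *)
Definition cliff_monomial (u : seq nat) : monomial delta :=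
  xget mone [set m : monomial delta | word m = u].

Definition suffix_le (m1 m2 : monomial delta) : Prop :=
  suffix (word m1) (word m2).

(* [suffix_le] is antisymmetric by [word_inj], so this is minimality.         *)
Definition suffix_min (M : set (monomial delta)) : set (monomial delta) :=
  [set m | M m /\ forall m', M m' -> suffix_le m' m -> m' = m].

Lemma cliffs_prefix u v : cliffs delta (u ++ v) -> cliffs delta u.
Proof.
move=> h i iu; have := h i; rewrite size_cat nth_cat iu; apply.
exact: leq_trans iu (leq_addr _ _).
Qed.

Lemma word1 : word mone = [::].
Proof. by rewrite /word fm1. Qed.

Lemma wordM m1 m2 : word (mmul m1 m2) = word m1 ++ word m2.
Proof. by rewrite /word fmM map_cat flatten_cat. Qed.

Lemma word_letter v : word (letter v) = val v.
Proof. by rewrite /word fmU /= cats0. Qed.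

Lemma word_exists u : cliffs delta u -> exists m, word m = u.
Proof.
have [n] := ubnP (size u); elim: n u => // n IHn u /ltnSE le_u_n clu.
have [->|/eqP u0] := eqVneq u [::]; first by exists mone; rewrite word1.
have [pu|npu] := pselect (prime_cliffs delta u).
  by exists (letter (SigSub (mem_set pu))); rewrite word_letter.
have [v [w [clv clw def_u v0 w0]]] : exists v w, [/\ cliffs delta v,
    cliffs delta w, u = v ++ w, v <> [::] & w <> [::]].
  apply: contrapT => H; apply: npu; split=> // v w clv clw def_u.
  apply: contrapT => /not_orP[v0 w0]; apply: H; by exists v, w.
have [|m1 e1] := IHn v _ clv.
  apply: leq_trans le_u_n; rewrite def_u size_cat -addn1 leq_add2l.
  by case: (w) w0.
have [|m2 e2] := IHn w _ clw.
  apply: leq_trans le_u_n; rewrite def_u size_cat -add1n leq_add2r.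
  by case: (v) v0.
by exists (mmul m1 m2); rewrite wordM e1 e2 def_u.
Qed.

Lemma word_cliff_monomial u :
  cliffs delta u -> word (cliff_monomial u) = u.
Proof.
by case/word_exists=> m mu; apply: (@xgetPex _ mone [set m | word m = u]); exists m.
Qed.

Lemma flatten_primes_inj (s1 s2 : seq (prime_cliffs delta)) :
  flatten [seq val p | p <- s1] = flatten [seq val p | p <- s2] -> s1 = s2.
Proof.
have prime_val (p : prime_cliffs delta) : prime_cliffs delta (val p).
  by apply: set_mem; apply: valP.
have last_eq (p q : prime_cliffs delta) x y : (size (val q) <= size (val p))%N ->
    x ++ val p = y ++ val q -> p = q.
  move=> le_qp eq_pq; apply: val_inj.
  have def_p : val p = take (size (val p) - size (val q)) (val p) ++ val q.
    rewrite -[X in _ ++ X](drop_size_cat (val q) (erefl (size y))) -eq_pq.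
    have -> : size y = (size x + (size (val p) - size (val q)))%N.
      by rewrite addnBA // -size_cat eq_pq size_cat addnK.
    by rewrite drop_cat ltnNge leq_addr /= addKn cat_take_drop.
  have [_ clp irr] := prime_val p; have [q0 clq _] := prime_val q.
  move: def_p; set w := take _ _ => def_p.
  have clw : cliffs delta w by apply: (@cliffs_prefix _ (val q)); rewrite -def_p.
  by case: (irr _ _ clw clq def_p) => // w0; rewrite def_p w0.
have neq0 (p : prime_cliffs delta) x : x ++ val p <> [::].
  by have [p0 _ _] := prime_val p; case: x => //=.
elim/last_ind: s1 s2 => [|s1 p IH] s2; case/lastP: s2 => [|s2 q] //;
  rewrite ?map_rcons ?flatten_rcons => eq12.
- by case: (neq0 q (flatten [seq val p | p <- s2])).
- by case: (neq0 p (flatten [seq val p | p <- s1])).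
have eq_pq : p = q.
  case/orP: (leq_total (size (val q)) (size (val p))) => le.
    exact: last_eq le eq12.
  by symmetry; apply: last_eq le (esym eq12).
have := congr1 size eq12; rewrite eq_pq !size_cat => /addIn eq_sz.
by move/eqP: eq12; rewrite eq_pq eqseq_cat // eqxx andbT => /eqP/IH->.
Qed.

Lemma word_inj : injective word.
Proof. by move=> m1 m2 /flatten_primes_inj eq12; apply: val_inj. Qed.

End Monomials.

Definition subspace (K : fieldType) (V : lmodType K) (U : set V) : Prop :=
  U 0 /\ forall (c : K) (x y : V), U x -> U y -> U (c *: x + y).

Definition linear_span (K : fieldType) (V : lmodType K) (S : set V) : set V :=
  smallest (@subspace K V) S.

Definition two_sided_ideal (A : pzRingType) (I : set A) : Prop :=
  [/\ I 0,
      forall x y : A, I x -> I y -> I (x - y),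
      forall a x : A, I x -> I (a * x) &
      forall a x : A, I x -> I (x * a)].

Definition ideal_generated (A : pzRingType) (S : set A) : set A :=
  smallest (@two_sided_ideal A) S.

Definition minimally_generates (A : pzRingType) (S I : set A) : Prop :=
  ideal_generated S = I /\
  forall T : set A, T `<` S -> ideal_generated T <> I.

Definition monomials_in (K : fieldType) (delta : nat -> nat)
    (M : set (monomial delta)) : set (free_algebra K delta) :=
  [set (<< m >> : {malg K[monomial delta]}) | m in M].
Arguments monomials_in K {delta} M.

(* [m <> mone] excludes the empty product of generators.                      *)
Definition relation_ideal (K : fieldType) (delta : nat -> nat) :
    set (free_algebra K delta) :=
  linear_span (monomials_in K
    [set m : monomial delta | m <> mone /\ ~ cliffs delta (word m)]).
Arguments relation_ideal K delta : clear implicits.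

Definition min_generators (delta : nat -> nat) : set (monomial delta) :=
  suffix_min
    [set m | exists u (v : prime_cliffs delta),
       [/\ cliffs delta u, ~ cliffs delta (u ++ val v) &
           m = mmul (cliff_monomial delta u) (letter v)]].
Arguments min_generators delta : clear implicits.

(* Main.v *)
Require Import Defs.
From mathcomp Require Import all_boot all_algebra.
From mathcomp Require Import finmap boolp classical_sets.
From mathcomp.multinomials Require Import monalg.

Set Implicit Arguments.
Unset Strict Implicit.
Unset Printing Implicit Defensive.

Import GRing.Theory.
Local Open Scope classical_set_scope.
Local Open Scope ring_scope.

(** The ideal [relation_ideal K delta] consists of the elements whose support
    contains only bad monomials, those whose word is not a cliff. The ideal
    generated by a set of monomials consists of the elements supported on the
    multiples of these monomials. Both sides being described by supports, the
    statement is one about the free monoid on the prime cliffs.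

    The central fact ([cliffs_word_mulr]) is that for a valley-free range map,
    a monomial dividing one whose word is a cliff has a cliff as word. Left
    factors are clear. For right factors, if [v] and [w] are cliffs but
    [v ++ w] is not, some letter of [w] fits under [delta] at its position
    [j] in [w] but not at its position [i] in [v ++ w]; were it to fit again at
    its position [k] in [u ++ v ++ w], then [delta] would have a valley at
    [j < i < k].

    Generation: cut a bad monomial just after its shortest bad left factor,
    which has the form [p * a_v] with [word p] a cliff, and take a minimal
    generator [t] whose word is a suffix of the word of [p * a_v]. This suffix
    relation between words is a divisibility of monomials: the part of the word
    left of [word t] must lie in the cliff [word p], as otherwise [word t] would
    be a suffix of the cliff [v], hence a cliff ([cliffs_word_suffix]); so this
    part is a cliff, hence the word of some monomial [x], and [x * t = p * a_v]
    as they have the same word.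

    Minimality: if a generator [g = p * a_v] equals [x * t * y] with [t] a
    generator, then [y = 1], since otherwise [t] would divide [p], whose word is
    a cliff. So [t] is a suffix of [g] and [t = g] by minimality of [g]. *)

(** * Ideals generated by monomials *)

Section MonomialIdeals.
Variables (K : fieldType) (N : monomType).
Implicit Types (S M : set N) (f g : {malg K[N]}) (m : N).

Definition supported_on M : set {malg K[N]} :=
  [set f | forall m, m \in msupp f -> M m].

Definition multiples S : set N :=
  [set m | exists x t y, S t /\ m = mmul (mmul x t) y].

Lemma supported_onU M m : supported_on M (<< m >> : {malg K[N]}) <-> M m.
Proof.
split=> [|Mm k]; first by apply; rewrite msuppU1 inE.
by rewrite msuppU1 inE => /eqP->.
Qed.

Lemma linear_span_monomials S :
  linear_span (V := {malg K[N]}) [set << m >> | m in S] = supported_on S.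
Proof.
rewrite eqEsubset; split.
  apply: smallest_sub => [|_ [m Sm <-]]; last exact/supported_onU.
  split=> [m|c f g Sf Sg m]; first by rewrite msupp0 inE.
  rewrite -mcoeff_neq0 mcoeffD mcoeffZ.
  case: (msuppP f m) => [/Sf//|_]; case: (msuppP g m) => [/Sg//|_].
  by rewrite mulr0 addr0 eqxx.
move=> f Sf V [[V0 VD] SV]; rewrite (monalgE f) big_seq.
elim/big_rec: _ => // m g /Sf Sm Vg.
have -> : << f@_m *g m >> = f@_m *: << m >> :> {malg K[N]}.
  by apply/malgP => k; rewrite mcoeffZ !mcoeffU mulrnAr mulr1.
by apply: VD => //; apply: SV; exists m.
Qed.

Lemma ideal_generated_monomials S :
  ideal_generated (A := {malg K[N]}) [set << m >> | m in S] =
  supported_on (multiples S).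
Proof.
rewrite eqEsubset; split.
  apply: smallest_sub => [|_ [t St <-]]; last first.
    by apply/supported_onU; exists mone, t, mone; rewrite mul1m mulm1.
  split=> [m|f g Sf Sg m|f g Sg m|f g Sg m].
  - by rewrite msupp0 inE.
  - rewrite -mcoeff_neq0 mcoeffB.
    case: (msuppP f m) => [/Sf//|_]; case: (msuppP g m) => [/Sg//|_].
    by rewrite subr0 eqxx.
  - case/msuppM_le => k [_ [_ /Sg[x [t [y [St ->]]]] ->]].
    by exists (mmul k x), t, y; rewrite !mulmA.
  case/msuppM_le => _ [k [/Sg[x [t [y [St ->]]]] _ ->]].
  by exists x, t, (mmul y k); rewrite !mulmA.
move=> f Sf I [[I0 IB ImulL ImulR] SI]; rewrite (monalgE f) big_seq.
elim/big_rec: _ => // m g /Sf[x [t [y [St ->]]]] Ig.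
rewrite -[g]opprK; apply: (IB) => //; last by rewrite -sub0r; apply: IB.
set c := f@_ _.
have -> : << c *g mmul (mmul x t) y >> =
    << c *g x >> * << t >> * << y >> :> {malg K[N]}.
  by rewrite !malgM_def !fgmulUU !mulr1.
by apply/ImulR/ImulL/SI; exists t.
Qed.

(** If no element of [S] properly divides another, a subset of [S] missing [g]
    does not generate [g]: the support of [g] is [g] itself, which is not a
    multiple of any other element of [S]. *)
Lemma minimally_generates_monomials S :
  (forall x t y, S t -> S (mmul (mmul x t) y) -> mmul (mmul x t) y = t) ->
  minimally_generates (A := {malg K[N]}) [set << m >> | m in S]
    (supported_on (multiples S)).
Proof.
move=> antichain; split=> [|T [TS nST]]; first exact: ideal_generated_monomials.
move=> defI; apply: nST => _ [g Sg <-]; apply: contrapT => nTg.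
have : supported_on (multiples [set t | S t /\ t <> g])
    (<< g >> : {malg K[N]}).
  rewrite -ideal_generated_monomials.
  have : ideal_generated T (<< g >> : {malg K[N]}).
    rewrite defI; apply/supported_onU.
    by exists mone, g, mone; rewrite mul1m mulm1.
  move=> Tg J [idJ subJ]; apply: Tg; split=> // f Tf; apply: subJ.
  have [t St def_f] := TS _ Tf.
  by exists t => //; split=> // tg; apply: nTg; rewrite -tg def_f.
case/supported_onU=> x [t [y [[St neq_tg] def_g]]].
by apply: neq_tg; rewrite def_g; apply/esym/antichain; rewrite -?def_g.
Qed.

End MonomialIdeals.

(** * Cliffs for a valley-free range map *)

Section Cliffs.
Variable delta : nat -> nat.
Implicit Types (m p t x y : monomial delta) (v : prime_cliffs delta).

Lemma cliffs_nil : cliffs delta [::].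
Proof. by []. Qed.

Lemma cliffs_letter v : cliffs delta (val v).
Proof. by have /set_mem[] := valP v. Qed.

Lemma monomial_ind_r (P : monomial delta -> Prop) :
  P mone -> (forall m v, P m -> P (mmul m (letter v))) -> forall m, P m.
Proof.
move=> P1 PM [s]; elim/last_ind: s => [|s v IHs].
  have -> //: FMonom [::] = mone :> monomial delta.
    by apply: val_inj; rewrite /= fm1.
have -> : FMonom (rcons s v) = mmul (FMonom s) (letter v) :> monomial delta.
  by apply: val_inj; rewrite /= fmM fmU cats1.
exact: PM.
Qed.

Lemma mulm_letter_inj m1 m2 v1 v2 :
  mmul m1 (letter v1) = mmul m2 (letter v2) -> m1 = m2.
Proof.
move/(congr1 (@fmonom_val _)); rewrite !fmM !fmU !cats1 => /rcons_inj[eq12 _].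
exact: val_inj.
Qed.

Hypothesis valleyF : valley_free delta.

(** A letter of [w] that breaks the bound in [v ++ w] but respects it in [w] and
    in [u ++ v ++ w] exhibits a valley. Its position gets strictly larger each
    time a nonempty word is put in front, whence the removal of the cases where
    [u] or [v] is empty. *)
Lemma cliffs_cat_suffix (u v w : seq nat) :
    cliffs delta v -> cliffs delta w -> cliffs delta (u ++ v ++ w) ->
  cliffs delta (v ++ w).
Proof.
case: u v => [|a u] [|b v] // clv clw cluvw i lt_i.
have [lt_iv|le_vi] := ltnP i (size (b :: v)).
  by have := clv i lt_iv; rewrite nth_cat lt_iv.
have := cluvw (size (a :: u) + i)%N.
rewrite [in X in X -> _]size_cat ltn_add2l lt_i => /(_ isT).
rewrite nth_cat ltnNge leq_addr /= addKn.
have := clw (i - size (b :: v))%N.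
rewrite ltn_subLR // -size_cat => /(_ lt_i).
rewrite -/(cat (b :: v) w) nth_cat [X in if X then _ else _]ltnNge le_vi /=.
set c := nth _ _ _ => le_c_j le_c_k; rewrite leqNgt; apply/negP => lt_i_c.
apply: (@valleyF (i - size (b :: v)).+1 i.+1 ((size u).+1 + i).+1).
- by rewrite /= ltnS ltn_subrL (leq_trans _ le_vi).
- by rewrite ltnS addSn ltnS leq_addl.
by split; [apply: leq_trans le_c_j | apply: leq_trans le_c_k].
Qed.

(** A suffix of a cliff need not be a cliff, but here it is a product of prime
    cliffs, and [cliffs_cat_suffix] adds these one at a time. *)
Lemma cliffs_word_suffix u m :
  cliffs delta (u ++ word m) -> cliffs delta (word m).
Proof.
elim/monomial_ind_r: m => [|m v IHm]; first by rewrite word1.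
rewrite wordM word_letter => cl_umv; apply: cliffs_cat_suffix (cl_umv).
  by apply/IHm/cliffs_prefix; rewrite -catA; exact: cl_umv.
exact: cliffs_letter.
Qed.

Lemma cliffs_word_mulr x t y :
  cliffs delta (word (mmul (mmul x t) y)) -> cliffs delta (word t).
Proof.
by rewrite !wordM => /cliffs_prefix; apply: cliffs_word_suffix.
Qed.

(** * Minimal generators *)

(** The products [a^u * a_v] of which the generators are the minimal ones, with
    the monomial [p = a^u] in place of the cliff [u]: by [word_inj] the two carry
    the same information, and [p] spares the partial map [cliff_monomial]. *)
Definition pregenerators : set (monomial delta) :=
  [set m | exists p v, [/\ cliffs delta (word p), ~ cliffs delta (word m) &
     m = mmul p (letter v)]].

Lemma min_generatorsE : min_generators delta = suffix_min pregenerators.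
Proof.
rewrite /min_generators; congr suffix_min; apply/seteqP; split=> m.
  case=> u [v [clu ncl ->]]; exists (cliff_monomial delta u), v.
  by rewrite wordM word_cliff_monomial // word_letter.
case=> p [v [clp ncl def_m]]; rewrite def_m wordM word_letter in ncl *.
exists (word p), v; split=> //; congr mmul; apply: word_inj.
by rewrite word_cliff_monomial.
Qed.

Lemma min_generators_bad t :
  min_generators delta t -> ~ cliffs delta (word t).
Proof. by rewrite min_generatorsE => -[[p [v [_ ncl _]]] _]. Qed.

Lemma suffix_min_exists (M : set (monomial delta)) m :
  M m -> exists2 t, suffix_min M t & suffix_le t m.
Proof.
have [n] := ubnP (size (word m)); elim: n m => // n IHn m /ltnSE le_mn Mm.
have [min_m|/not_andP[//|/existsNP[m' nmin]]] := pselect (suffix_min M m).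
  by exists m => //; apply: suffix_refl.
have /not_implyP[Mm' /not_implyP[le_m'm neq]] := nmin.
have [|t min_t le_tm'] := IHn m' _ Mm'; last first.
  by exists t => //; apply: suffix_trans le_m'm.
apply: leq_trans le_mn; have /suffixP[[|a u] def_m] := le_m'm.
  by case: neq; apply: word_inj; rewrite def_m.
by rewrite def_m size_cat /= ltnS leq_addl.
Qed.

(** The part of the word left of [word t] must be a prefix of [word p]: else
    [word t] would be a suffix of the cliff [val v], hence a cliff. *)
Lemma bad_suffix_dvd p v t :
    cliffs delta (word p) -> ~ cliffs delta (word t) ->
    suffix_le t (mmul p (letter v)) ->
  exists x, mmul p (letter v) = mmul x t.
Proof.
move=> clp nclt /suffixP[w]; rewrite wordM word_letter => eq_w.
have [le_wp|/ltnW le_pw] := leqP (size w) (size (word p)).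
  have clw : cliffs delta w.
    apply: (@cliffs_prefix _ _ (drop (size w) (word p))).
    have := congr1 (take (size w)) eq_w.
    rewrite take_size_cat // takel_cat // => def_w.
    by rewrite -{1}def_w cat_take_drop.
  have [x def_w] := word_exists clw.
  by exists x; apply: word_inj; rewrite !wordM word_letter def_w.
case: nclt; apply: (@cliffs_word_suffix (drop (size (word p)) w)).
suff <- : val v = drop (size (word p)) w ++ word t by apply: cliffs_letter.
have := congr1 (drop (size (word p))) eq_w.
rewrite (drop_size_cat _ (erefl _)) drop_cat; case: ltngtP le_pw => // -> _.
by rewrite subnn drop0 drop_size.
Qed.

(** The product is found by cutting [m] just after its first letter whose
    inclusion stops the word from being a cliff. *)
Lemma pregenerators_dvd m :
  ~ cliffs delta (word m) -> exists g y, pregenerators g /\ m = mmul g y.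
Proof.
elim/monomial_ind_r: m => [|m v IHm]; first by rewrite word1 => /(_ cliffs_nil).
move=> ncl_mv; have [clm|] := pselect (cliffs delta (word m)).
  by exists (mmul m (letter v)), mone; rewrite mulm1; split=> //; exists m, v.
case/IHm=> g [y [g_pre ->]].
by exists g, (mmul y (letter v)); rewrite mulmA.
Qed.

Lemma multiples_min_generators :
  multiples (min_generators delta) = [set m | ~ cliffs delta (word m)].
Proof.
apply/seteqP; split=> m.
  by case=> x [t [y [/min_generators_bad nclt ->]]] /cliffs_word_mulr.
case/pregenerators_dvd=> g [y [g_pre ->]].
have [t min_t le_tg] := suffix_min_exists g_pre.
rewrite -min_generatorsE in min_t.
have [p [v [clp _ def_g]]] := g_pre; rewrite def_g in le_tg *.
have [x ->] := bad_suffix_dvd clp (min_generators_bad min_t) le_tg.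
by exists x, t, y.
Qed.

(** A nontrivial right factor [y] would absorb the last letter of the larger
    generator and leave the bad [t] dividing a monomial with a cliff as word. *)
Lemma min_generators_antichain x t y :
    min_generators delta t -> min_generators delta (mmul (mmul x t) y) ->
  mmul (mmul x t) y = t.
Proof.
move=> gen_t; rewrite [X in X _ -> _]min_generatorsE.
have nclt := min_generators_bad gen_t.
elim/monomial_ind_r: y => [|y w _]; rewrite ?mulm1.
  case=> _ /(_ t) min_xt; apply/esym/min_xt; last first.
    by rewrite /suffix_le wordM suffix_suffix.
  by move: gen_t; rewrite min_generatorsE => -[].
case=> [[p [v [clp _]]]] + _; rewrite mulmA => /mulm_letter_inj def_p.
by case: nclt; apply: (@cliffs_word_mulr x t y); rewrite def_p.
Qed.

End Cliffs.

Theorem proposition3p2p8 (K : fieldType) (delta : nat -> nat) :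
  [pchar K] =i pred0 ->
  valley_free delta ->
  minimally_generates (monomials_in K (min_generators delta))
    (relation_ideal K delta).
Proof.
move=> _ valleyF.
have -> : relation_ideal K delta =
    supported_on (K := K) (multiples (min_generators delta)).
  rewrite multiples_min_generators // /relation_ideal.
  rewrite [LHS]linear_span_monomials; congr supported_on.
  apply/seteqP; split=> m; first by case.
  by move=> ncl; split=> // m1; apply: ncl; rewrite m1 word1; apply: cliffs_nil.
apply: minimally_generates_monomials => x t y.
exact: min_generators_antichain.
Qed.
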